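(* Let $(\beta^*,\varphi^* )\in\{0,1\}^B\times\{0,1\}^{F\times T}$ be a fixed, exogenously given bid selection, and consider the optimization problem $(\mathrm{QPRelax}_{\beta^*,\varphi^*})$ in the variables $(\delta,\tau)\in\mathbb{R}^H\times\mathbb{R}^{C\times T}$ defined in the context. A feasible solution $(\delta,\tau)$ of $(\mathrm{QPRelax}_{\beta^*,\varphi^*})$ is an optimal solution of $(\mathrm{QPRelax}_{\beta^*,\varphi^*})$ if and only if there exist prices $\pi\in\mathbb{R}^{A\times T}$ such that $(\delta,\pi)$ satisfies the filling condition and $(\tau,\pi)$ satisfies the flow price condition. These prices $\pi$ are given by the optimal dual variables of the clearing constraints of $(\mathrm{QPRelax}_{\beta^*,\varphi^*})$.
   Context: Data. $A$ is a finite set of market areas; $T=\{0,1,\dots,N-1\}$ is the set of consecutive time slots. $H$ is a finite set of linear bid curves, the disjoint union of the sets $H_{a,t}$ ($a\in A$, $t\in T$) of bid curves in area $a$ at time $t$. Each $h\in H$ has quantity bounds $\underline\delta_h\le 0\le\overline\delta_h$ and an affine non-increasing function $m_h:[\underline\delta_h,\overline\delta_h]\to\mathbb{R}$, $m_h(u)=p_h-\Delta p_h\,u$ with $\Delta p_h\ge 0$. $B$ is a finite set of block bids, the disjoint union of sets $B_a$ ($a\in A$); each $b\in B$ has quantities $q_{b,t}\in\mathbb{R}$ ($t\in T$) and a price $p_b\in\mathbb{R}$. $F$ is a finite set of flexible bids, the disjoint union of sets $F_a$ ($a\in A$); each $f\in F$ has a quantity $q_f\in\mathbb{R}$ and a price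 $p_f\in\mathbb{R}$. $C\subset A\times A$ is the set of interconnectors; $C_a^+=\{(r,s)\in C: r=a\}$ and $C_a^-=\{(r,s)\in C: s=a\}$. Each $c\in C$ has real capacity bounds $\underline\tau_{c,t}\le\overline\tau_{c,t}$ ($t\in T$), a ramp rate $\widetilde\tau_c\in[0,\infty]$, and a given constant $\tau_{c,-1}\in\mathbb{R}$ (flow in the last slot of the previous day). If $\widetilde\tau_c=\infty$ there is no ramping constraint on $c$ and the multipliers $\overline\rho_{c,t},\underline\rho_{c,t}$ below are $0$. Problem $(\mathrm{QPRelax}_{\beta^*,\varphi^*})$, for a parameter $(\beta^*,\varphi^* )\in\{0,1\}^B\times\{0,1\}^{F\times T}$: maximize over $(\delta,\tau)$ $$\sum_{h\in H}\int_0^{\delta_h}m_h(u)\,du+\sum_{b\in B,\,t\in T}p_b q_{b,t}\beta^*_b+\sum_{f\in F,\,t\in T}p_f q_f\varphi^*_{f,t}$$ subject to, for all $a\in A$, $t\in T$, the clearing constraint $$\sum_{h\in H_{a,t}}\delta_h+\sum_{c\in C_a^+}\tau_{c,t}-\sum_{c\in C_a^-}\tau_{c,t}+\sum_{b\in B_a}q_{b,t}\beta^*_b+\sum_{f\in F_a}q_f\varphi^*_{f,t}=0,$$ and $\underline\delta_h\le\delta_h\le\overline\delta_h$ for all $h\in H$; $\underline\tau_{c,t}\le\tau_{c,t}\le\overline\tau_{c,t}$ and $-\widetilde\tau_c\le\tau_{c,t}-\tau_{c,t-1}\le\widetilde\tau_c$ for all $c\in C$, $t\in T$. Dual variables: $\pi_{a,t}$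 is the multiplier of the clearing constraint of $(a,t)$, with the sign convention that the Lagrangian is (minus the objective) $+\sum_{a,t}\pi_{a,t}\cdot$(left-hand side of the clearing constraint) $+$ nonnegative multipliers times the inequality constraints written in the form $g\le 0$. Filling condition for $(\delta,\pi)$, where $\underline\delta_h\le\delta_h\le\overline\delta_h$ for $h\in H$ and $\pi\in\mathbb{R}^{A\times T}$: there exist $\overline v,\underline v\in\mathbb{R}^H$ such that for all $a\in A$, $t\in T$, $h\in H_{a,t}$: $-m_h(\delta_h)+\pi_{a,t}+\overline v_h-\underline v_h=0$, $(\delta_h-\overline\delta_h)\overline v_h=0$, $(-\delta_h+\underline\delta_h)\underline v_h=0$, and $\overline v_h,\underline v_h\ge 0$. Flow price condition for $(\tau,\pi)$, where $\underline\tau_{c,t}\le\tau_{c,t}\le\overline\tau_{c,t}$ and $\pi\in\mathbb{R}^{A\times T}$: there exist $\overline\mu,\underline\mu,\overline\rho,\underline\rho\in\mathbb{R}^{C\times T}$ such that for all $c=(r,s)\in C$ and $t\in T$: $\overline\mu_{c,t},\underline\mu_{c,t},\overline\rho_{c,t},\underline\rho_{c,t}\ge 0$; $(\overline\mu_{c,t}-\underline\mu_{c,t})+(\overline\rho_{c,t}-\underline\rho_{c,t})+[\underline\rho_{c,t+1}-\overline\rho_{c,t+1}]+\pi_{r,t}-\pi_{s,t}=0$, where the term in square brackets is present only if $t+1\in T$; $(\tau_{c,t}-\overline\tau_{c,t})\overline\mu_{c,t}=0$; $(-\tau_{c,t}+\underline\tau_{c,t})\underline\mu_{c,t}=0$;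 $(\tau_{c,t}-\tau_{c,t-1}-\widetilde\tau_c)\overline\rho_{c,t}=0$; $(\tau_{c,t-1}-\tau_{c,t}-\widetilde\tau_c)\underline\rho_{c,t}=0$. *)

(* Defs.v *)
From HB Require Import structures.
From mathcomp Require Import all_boot all_order all_algebra.
From mathcomp Require Import all_classical all_reals all_analysis.

Set Implicit Arguments.
Unset Strict Implicit.
Unset Printing Implicit Defensive.

Import Order.TTheory GRing.Theory Num.Theory.

Local Open Scope ring_scope.

(* Integral of f from a to b, with the usual sign change when b < a; needed
   because a cleared quantity may be negative. *)
Definition oriented_integral (R : realType) (f : R -> R) (a b : R) : R :=
  if a <= b then Rintegral lebesgue_measure `[a, b]%classic f
  else - Rintegral lebesgue_measure `[b, a]%classic f.

(* The indexed families H_{a,t}, B_a, F_a of disjoint sets are encoded by the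
   maps sending each bid to its area (and, for a curve, its time slot). *)
Record market (R : realType) (A H B F : finType) (N : nat) := Market {
  curve_area : H -> A;
  curve_slot : H -> 'I_N;
  delta_lo : H -> R;
  delta_hi : H -> R;
  curve_price : H -> R;
  curve_slope : H -> R;
  block_area : B -> A;
  block_qty : B -> 'I_N -> R;
  block_price : B -> R;
  flex_area : F -> A;
  flex_qty : F -> R;
  flex_price : F -> R;
  conn : {set A * A};
  tau_lo : {c : A * A | c \in conn} -> 'I_N -> R;
  tau_hi : {c : A * A | c \in conn} -> 'I_N -> R;
  ramp : {c : A * A | c \in conn} -> \bar R;
  (* flow in the last slot of the previous day *)
  tau_init : {c : A * A | c \in conn} -> R;
  delta_lo_le0 : forall h, delta_lo h <= 0;
  delta_hi_ge0 : forall h, 0 <= delta_hi h;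
  curve_slope_ge0 : forall h, 0 <= curve_slope h;
  tau_lo_le_hi : forall c t, tau_lo c t <= tau_hi c t;
  ramp_ge0 : forall c, (0 <= ramp c)%E }.

Arguments tau_lo {R A H B F N} m.
Arguments tau_hi {R A H B F N} m.
Arguments ramp {R A H B F N} m.
Arguments tau_init {R A H B F N} m.

Section Market.
Context (R : realType) (A H B F : finType) (N : nat).
Variable D : market R A H B F N.

Definition line : finType := {c : A * A | c \in conn D}.

Definition curves_at (a : A) (t : 'I_N) : {set H} :=
  [set h | (curve_area D h == a) && (curve_slot D h == t)].
Definition blocks_in (a : A) : {set B} := [set b | block_area D b == a].
Definition flex_in (a : A) : {set F} := [set f | flex_area D f == a].
Definition lines_from (a : A) : {set line} := [set c : line | (val c).1 == a].
Definition lines_to (a : A) : {set line} := [set c : line | (val c).2 == a].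

(* The affine formula is kept outside [delta_lo h, delta_hi h] as well, so that
   the objective makes sense on all of R^H. *)
Definition bid_curve (h : H) (u : R) : R :=
  curve_price D h - curve_slope D h * u.

(* For t > 0 the cyclic predecessor ord_pred t is t - 1. *)
Definition prev_flow (tau : line -> 'I_N -> R) (c : line) (t : 'I_N) : R :=
  if t == 0 :> nat then tau_init D c else tau c (ord_pred t).

Definition flow_change (tau : line -> 'I_N -> R) (c : line) (t : 'I_N) : R :=
  tau c t - prev_flow tau c t.

Section Problem.
Variables (beta : B -> bool) (phi : F -> 'I_N -> bool).

Definition objective (delta : H -> R) : R :=
  \sum_(h : H) oriented_integral (bid_curve h) 0 (delta h)
  + \sum_(b : B) \sum_(t < N) block_price D b * block_qty D b t * (beta b)%:R
  + \sum_(f : F) \sum_(t < N) flex_price D f * flex_qty D f * (phi f t)%:R.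

Definition clearing_lhs (delta : H -> R) (tau : line -> 'I_N -> R)
    (a : A) (t : 'I_N) : R :=
  \sum_(h in curves_at a t) delta h
  + \sum_(c in lines_from a) tau c t
  - \sum_(c in lines_to a) tau c t
  + \sum_(b in blocks_in a) block_qty D b t * (beta b)%:R
  + \sum_(f in flex_in a) flex_qty D f * (phi f t)%:R.

Definition curve_bounds (delta : H -> R) : Prop :=
  forall h, delta_lo D h <= delta h <= delta_hi D h.

Definition flow_bounds (tau : line -> 'I_N -> R) : Prop :=
  forall c t, tau_lo D c t <= tau c t <= tau_hi D c t.

Definition feasible (delta : H -> R) (tau : line -> 'I_N -> R) : Prop :=
  [/\ forall a t, clearing_lhs delta tau a t = 0,
      curve_bounds delta,
      flow_bounds tau
    & forall c t,
        (- ramp D c <= (flow_change tau c t)%:E <= ramp D c)%E].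

Definition optimal (delta : H -> R) (tau : line -> 'I_N -> R) : Prop :=
  feasible delta tau /\
  forall delta' tau', feasible delta' tau' -> objective delta' <= objective delta.

Record multipliers := Multipliers {
  clearing_mult : A -> 'I_N -> R;
  v_hi : H -> R;
  v_lo : H -> R;
  mu_hi : line -> 'I_N -> R;
  mu_lo : line -> 'I_N -> R;
  rho_hi : line -> 'I_N -> R;
  rho_lo : line -> 'I_N -> R }.

Definition dual_feasible (l : multipliers) : Prop :=
  [/\ forall h, 0 <= v_hi l h /\ 0 <= v_lo l h,
      forall c t, 0 <= mu_hi l c t /\ 0 <= mu_lo l c t,
      forall c t, 0 <= rho_hi l c t /\ 0 <= rho_lo l c t
    & forall c t, ramp D c = +oo%E -> rho_hi l c t = 0 /\ rho_lo l c t = 0].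

(* fine (ramp D c) is a junk value when ramp D c = +oo, but then dual_feasible
   forces the ramping multipliers of c to be 0. *)
Definition lagrangian (l : multipliers)
    (delta : H -> R) (tau : line -> 'I_N -> R) : R :=
  - objective delta
  + \sum_(a : A) \sum_(t < N) clearing_mult l a t * clearing_lhs delta tau a t
  + \sum_(h : H) (v_hi l h * (delta h - delta_hi D h)
                  + v_lo l h * (- delta h + delta_lo D h))
  + \sum_(c : line) \sum_(t < N)
      (mu_hi l c t * (tau c t - tau_hi D c t)
       + mu_lo l c t * (- tau c t + tau_lo D c t))
  + \sum_(c : line) \sum_(t < N)
      (rho_hi l c t * (flow_change tau c t - fine (ramp D c))
       + rho_lo l c t * (- flow_change tau c t - fine (ramp D c))).

Definition dual_objective (l : multipliers) : \bar R :=
  ereal_inf (range (fun x : (H -> R) * (line -> 'I_N -> R) =>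
                      (lagrangian l x.1 x.2)%:E)).

Definition dual_optimal (l : multipliers) : Prop :=
  dual_feasible l /\
  forall l', dual_feasible l' -> (dual_objective l' <= dual_objective l)%E.

End Problem.

Definition filling_condition (delta : H -> R) (pi : A -> 'I_N -> R) : Prop :=
  curve_bounds delta /\
  exists vhi vlo : H -> R,
    forall a t h, h \in curves_at a t ->
      [/\ - bid_curve h (delta h) + pi a t + vhi h - vlo h = 0,
          (delta h - delta_hi D h) * vhi h = 0,
          (- delta h + delta_lo D h) * vlo h = 0,
          0 <= vhi h
        & 0 <= vlo h].

(* For t + 1 < N the cyclic successor ordS t is t + 1. *)
Definition next_ramp (rhohi rholo : line -> 'I_N -> R) (c : line) (t : 'I_N) : R :=
  if (t.+1 < N)%N then rholo c (ordS t) - rhohi c (ordS t) else 0.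

Definition flow_price_condition
    (tau : line -> 'I_N -> R) (pi : A -> 'I_N -> R) : Prop :=
  flow_bounds tau /\
  exists muhi mulo rhohi rholo : line -> 'I_N -> R,
    forall (c : line) (t : 'I_N),
      [/\ [/\ 0 <= muhi c t, 0 <= mulo c t, 0 <= rhohi c t & 0 <= rholo c t],
          ramp D c = +oo%E -> rhohi c t = 0 /\ rholo c t = 0,
          (muhi c t - mulo c t) + (rhohi c t - rholo c t)
            + next_ramp rhohi rholo c t
            + pi (val c).1 t - pi (val c).2 t = 0,
          (tau c t - tau_hi D c t) * muhi c t = 0
          /\ (- tau c t + tau_lo D c t) * mulo c t = 0
        & (tau c t - prev_flow tau c t - fine (ramp D c)) * rhohi c t = 0
          /\ (prev_flow tau c t - tau c t - fine (ramp D c)) * rholo c t = 0].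

End Market.

(* Main.v *)
Require Import Defs.
From mathcomp Require Import all_boot all_order all_algebra.
From mathcomp Require Import all_classical all_reals all_analysis.
From mathcomp Require Import ring lra.

Set Implicit Arguments.
Unset Strict Implicit.
Unset Printing Implicit Defensive.

Import Order.TTheory GRing.Theory Num.Theory.
Import numFieldNormedType.Exports.

Local Open Scope classical_set_scope.
Local Open Scope ring_scope.

(** The problem maximizes a separable concave quadratic function under
finitely many linear constraints, so strong Lagrangian duality needs no
constraint qualification; both parts of the theorem are read off from it.

Call a multiplier vector [l] a certificate for [delta] when it is dual feasible
and the Lagrangian at [l] is bounded below, over all of the variable space, by
minus the objective at [delta].  Everything is expressed through certificates.

- A certificate proves optimality, since the Lagrangian never exceeds minus the
  objective at a feasible point ([weak_duality], [certificate_optimal]).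
- An optimal point has a certificate ([optimal_certificate]).  This is the only
  deep direction.  At an optimum no direction of the cone cut out by the active
  constraints increases the objective to first order, so Farkas' lemma writes
  the gradient as a nonnegative combination of active constraint normals
  ([farkas], [quadratic_kkt]).  With these multipliers the linear part of the
  Lagrangian vanishes, and what is left is a nonnegative quadratic form.
- Certificates are exactly the Karush-Kuhn-Tucker points ([kkt_certificate],
  [certificate_kkt]).  The Lagrangian is a quadratic function whose linear
  coefficients are the left-hand sides of the filling and of the flow price
  equations ([lagrangian_taylor]): minimality at the given point forces them to
  vanish, and a bound attained there forces complementary slackness.
- As soon as some certificate exists, the dual optimal multipliers are exactly
  the certificates ([dual_optimal_certificate]), because the dual optimal value
  is then minus the optimal value of the problem. *)

(** * Farkas' lemma *)

Section Farkas.
Context (R : realFieldType) (V : lmodType R).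

(** Induction on the number of functionals, following Bartl.  If dropping the
first functional makes the hypothesis fail, the direction [x0] witnessing the
failure satisfies [alpha ord0 x0 > 0]; composing everything with the projection
along [x0] onto the kernel of [alpha ord0] removes that functional, and undoing
the projection gives its multiplier, nonnegative by the choice of [x0]. *)
Lemma farkas_ord n (alpha : 'I_n -> V -> R) (g : V -> R) :
  (forall j, scalar (alpha j)) -> scalar g ->
  (forall d, (forall j, alpha j d <= 0) -> g d <= 0) ->
  exists2 lam : 'I_n -> R, (forall j, 0 <= lam j) &
    forall d, g d = \sum_j lam j * alpha j d.
Proof.
elim: n alpha g => [|n IHn] alpha g alphaL gL cone.
  exists (fun=> 0) => // d; rewrite big_ord0; apply/eqP.
  (* without constraints the hypothesis applies to d and to its opposite *)
  rewrite eq_le cone => [|[]//]; rewrite -oppr_le0.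
  have -> : - g d = g (-1 *: d + 0) by rewrite gL; have := gL (-1) 0 0;
    rewrite scaler0 add0r; lra.
  by apply: cone => -[].
have [cone'|/existsNP[x0 /not_implyP[x0le /negP]]] :=
    pselect (forall d, (forall j, alpha (lift ord0 j) d <= 0) -> g d <= 0).
  have [lam lam0 glam] := IHn _ _ (fun j => alphaL _) gL cone'.
  exists (fun j => oapp lam 0 (unlift ord0 j)) => [j|d].
    by case: unliftP => //=.
  rewrite big_ord_recl unlift_none /= mul0r add0r glam.
  by apply: eq_bigr => j _; rewrite liftK.
rewrite -ltNge => gx0.
pose a0 := alpha ord0.
have a0x0 : 0 < a0 x0.
  rewrite ltNge; apply/negP => a0le; move: gx0; rewrite ltNge cone// => j.
  by case: (unliftP ord0 j) => [k ->|->].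
pose P d := (- (a0 d / a0 x0)) *: x0 + d.
have a0L := alphaL ord0.
have PL (f : V -> R) : scalar f -> scalar (f \o P).
  move=> fL k u v /=; rewrite /P !fL /a0 a0L -/a0; ring.
have [|lam lam0 glam] :=
    IHn (fun j => alpha (lift ord0 j) \o P) (g \o P) (fun j => PL _ (alphaL _)) (PL _ gL).
  move=> d dle; apply: cone => j; case: (unliftP ord0 j) => [k ->|->]; first exact: dle.
  by rewrite /P a0L -/a0 mulNr divfK ?gt_eqF// addNr.
pose s := \sum_j lam j * alpha (lift ord0 j) x0.
have s0 : s <= 0 by apply: sumr_le0 => j _; rewrite mulr_ge0_le0.
exists (fun j => oapp lam ((g x0 - s) / a0 x0) (unlift ord0 j)) => [j|d].
  case: unliftP => //= _; rewrite divr_ge0 ?(ltW a0x0)//; lra.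
rewrite big_ord_recl unlift_none /=.
under eq_bigr do rewrite liftK /=.
have := glam d; rewrite /= {1}/P gL.
under eq_bigr do rewrite /P alphaL mulrDr mulrCA.
rewrite big_split /= -mulr_sumr -/s => /(canRL (addKr _)) ->.
rewrite -/a0; ring.
Qed.

Lemma farkas (J : finType) (alpha : J -> V -> R) (g : V -> R) :
  (forall j, scalar (alpha j)) -> scalar g ->
  (forall d, (forall j, alpha j d <= 0) -> g d <= 0) ->
  exists2 lam : J -> R, (forall j, 0 <= lam j) &
    forall d, g d = \sum_j lam j * alpha j d.
Proof.
move=> alphaL gL cone.
have [||lam lam0 glam] := @farkas_ord _ (fun k : 'I_#|J| => alpha (enum_val k)) g _ gL.
- by move=> k; exact: alphaL.
- by move=> d dle; apply: cone => j; rewrite -(enum_rankK j).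
exists (lam \o enum_rank) => [j|d]; first exact: lam0.
rewrite glam (reindex (@enum_rank J)) /=; last exact/onW_bij/enum_rank_bij.
by apply: eq_bigr => j _; rewrite enum_rankK.
Qed.
End Farkas.

(** * Optimality conditions under two-sided linear constraints *)

Section KKT.
Context (R : realType).

(** Feasibility of a small step: a slack bound tolerates any direction, a tight
bound tolerates those that do not increase the constrained quantity. *)
Lemma near0_le (x d : R) (u : \bar R) : (x%:E <= u)%E -> (u = x%:E -> d <= 0) ->
  \forall e \near 0^'+, ((x + e * d)%:E <= u)%E.
Proof.
case: u => [u||//]; last by move=> *; apply: nearW => e; exact: leey.
rewrite lee_fin le_eqVlt => /predU1P[<- /(_ erefl) d0|xu _].
  by near=> e; rewrite lee_fin gerDl pmulr_rle0.
have e0 : 0 < (u - x) / (`|d| + 1) by rewrite divr_gt0 ?subr_gt0 ?ltr_wpDl.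
near=> e; rewrite lee_fin -lerBrDl.
have : e <= (u - x) / (`|d| + 1) by near: e; exact: nbhs_right_le.
rewrite ler_pdivlMr ?ltr_wpDl//; apply: le_trans.
by rewrite ler_pM2l// (le_trans (ler_norm _))// lerDl.
Unshelve. all: by end_near. Qed.

(** First-order optimality conditions for a gain [g - q], with [g] linear and
[q] homogeneous of degree two, along directions [d] that keep the linear
quantities [z j] between their bounds.  Infinite bounds are allowed; being never
attained, they get a zero multiplier like any other inactive bound. *)
Lemma quadratic_kkt (V : lmodType R) (J : finType) (form : J -> V -> R) (z : J -> R)
    (lo hi : J -> \bar R) (g q : V -> R) :
  (forall j, scalar (form j)) -> scalar g ->
  (forall e d, q (e *: d) = e ^+ 2 * q d) ->
  (forall j, lo j <= (z j)%:E <= hi j)%E ->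
  (forall d, (forall j, lo j <= (z j + form j d)%:E <= hi j)%E -> g d <= q d) ->
  exists lamhi lamlo : J -> R,
    [/\ forall j, 0 <= lamhi j /\ 0 <= lamlo j,
        forall j, hi j != (z j)%:E -> lamhi j = 0,
        forall j, lo j != (z j)%:E -> lamlo j = 0
      & forall d, g d = \sum_j (lamhi j - lamlo j) * form j d].
Proof.
move=> formL gL q2 zb opt.
have scZ (f : V -> R) : scalar f -> forall e d, f (e *: d) = e * f d.
  move=> fL e d; have := fL e d 0; have := fL 1 0 0.
  by rewrite scale1r !addr0 mul1r => f0 ->; lra.
(* the index true stands for the upper bound, false for the lower one;
   inactive constraints are replaced by the zero functional *)
pose act (b : bool) j := (if b then hi j else lo j) == (z j)%:E.
pose alpha (bj : bool * J) d :=
  if act bj.1 bj.2 then (-1) ^+ (~~ bj.1) * form bj.2 d else 0.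
have [||lam lam0 glam] := @farkas R V _ alpha g _ gL.
- move=> [b j] k u v; rewrite /alpha; case: ifP => _; last by rewrite mulr0 addr0.
  by rewrite formL; ring.
- move=> d dle.
  have [gd0|gd0] := leP (g d) 0 => //.
  have ball : \forall e \near 0^'+,
      forall j, (lo j <= (z j + form j (e *: d))%:E <= hi j)%E.
    apply: filter_forall => j; have /andP[loz zhi] := zb j.
    have hiP : \forall e \near 0^'+, ((z j + e * form j d)%:E <= hi j)%E.
      apply: near0_le => // hij; have := dle (true, j).
      by rewrite /alpha /act /= hij eqxx expr0 mul1r.
    have loP : \forall e \near 0^'+, ((- z j + e * - form j d)%:E <= - lo j)%E.
      apply: near0_le => [|loj]; first by rewrite EFinN leeN2.
      have := dle (false, j); rewrite /alpha /act /=.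
      have -> : lo j = (z j)%:E by rewrite -(oppeK (lo j)) loj -EFinN opprK.
      by rewrite eqxx expr1 mulN1r.
    near=> e; rewrite scZ//; apply/andP; split; last by near: e.
    rewrite -leeN2 -EFinN opprD -mulrN; near: e; exact: loP.
  (* if g d > 0, a step e < g d / |q d| would be a feasible strict gain *)
  have e0 : 0 < g d / (`|q d| + 1) by rewrite divr_gt0 ?ltr_wpDl.
  suff : \forall e \near (0 : R)^'+, False by move/filter_ex => [].
  near=> e.
  have eb : e <= g d / (`|q d| + 1) by near: e; exact: nbhs_right_le.
  have e_gt0 : 0 < e by near: e; exact: nbhs_right_gt.
  have /opt : forall j, (lo j <= (z j + form j (e *: d))%:E <= hi j)%E by near: e.
  rewrite scZ// q2 expr2 -mulrA ler_pM2l// leNgt => /negP; apply.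
  move: eb; rewrite ler_pdivlMr ?ltr_wpDl//; apply: lt_le_trans.
  by rewrite ltr_pM2l// (le_lt_trans (ler_norm _))// ltrDl.
exists (fun j => if act true j then lam (true, j) else 0),
       (fun j => if act false j then lam (false, j) else 0); split.
- by move=> j; split; case: ifP.
- by move=> j /negPf; rewrite /act => ->.
- by move=> j /negPf; rewrite /act => ->.
move=> d; have -> : g d = \sum_b \sum_j lam (b, j) * alpha (b, j) d.
  by rewrite glam pair_bigA; apply: eq_bigr => -[].
rewrite big_bool /= -big_split /=; apply: eq_bigr => j _.
by rewrite /alpha /=; do 2 case: ifP => _ /=; ring.
Unshelve. all: by end_near. Qed.
End KKT.

(** * Affine integrals and elementary sign facts *)

Section AffineIntegral.
Context (R : realType) (p s : R).

Lemma Rintegral_affine (a b : R) : a < b ->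
  Rintegral lebesgue_measure `[a, b] (fun u => p - s * u) =
  (p * b - s / 2 * b ^+ 2) - (p * a - s / 2 * a ^+ 2).
Proof.
move=> ab; pose F (u : R) : R := p * u - s / 2 * u ^+ 2.
have dF (u : R) : is_derive u 1 F (p - s * u).
  by rewrite /F; apply: is_derive_eq; rewrite /GRing.scale /=; field.
have cF : continuous F.
  move=> u; apply: differentiable_continuous; apply/derivable1_diffP.
  by case: (dF u).
rewrite /Rintegral (@continuous_FTC2 _ _ F a b ab)//.
- apply: continuous_subspaceT => u.
  apply: cvgB; first exact: cvg_cst.
  by apply: cvgM; [exact: cvg_cst|exact: cvg_id].
- split.
  + by move=> u _; case: (dF u).
  + by apply: cvg_at_right_filter; exact: cF.
  + by apply: cvg_at_left_filter; exact: cF.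
- by move=> u _; rewrite derive1E; case: (dF u).
Qed.

Lemma oriented_integral_affine (d : R) :
  oriented_integral (fun u => p - s * u) 0 d = p * d - s / 2 * d ^+ 2.
Proof.
rewrite /oriented_integral; case: ltgtP => [d0|d0|<-].
- by rewrite Rintegral_affine//; ring.
- by rewrite Rintegral_affine//; ring.
- by rewrite set_itv1 Rintegral_set1; ring.
Qed.
End AffineIntegral.

(** Testing [x = - g / (s + 1)] gives [0 <= - (g / (s + 1)) ^+ 2]. *)
Lemma linear_coef0 (R : realFieldType) (g s : R) : 0 <= s ->
  (forall x, 0 <= g * x + s * x ^+ 2) -> g = 0.
Proof.
move=> s0 /(_ (- g / (s + 1))).
have s1 : s + 1 != 0 by rewrite gt_eqF// ltr_wpDl.
have -> : g * (- g / (s + 1)) + s * (- g / (s + 1)) ^+ 2 = - (g / (s + 1)) ^+ 2.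
  by field.
rewrite oppr_ge0 => gle; apply/eqP; move: gle.
by rewrite le_eqVlt ltNge sqr_ge0 orbF sqrf_eq0 mulf_eq0 invr_eq0 (negPf s1) orbF.
Qed.

Lemma sum_le0_eq0 (R : numDomainType) (I : finType) (f : I -> R) :
  (forall i, f i <= 0) -> 0 <= \sum_i f i -> forall i, f i = 0.
Proof.
move=> f0 s0 i; apply: oppr_inj; rewrite oppr0.
apply: (@psumr_eq0P R I xpredT (fun i => - f i)) => //.
  by move=> j _; rewrite oppr_ge0.
rewrite sumrN; apply/eqP; rewrite oppr_eq0 eq_le s0 andbT.
exact: sumr_le0.
Qed.

(** * Expansion of the objective and of the Lagrangian *)

Section Market.
Context (R : realType) (A H B F : finType) (N : nat) (D : market R A H B F N).
Context (beta : B -> bool) (phi : F -> 'I_N -> bool).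

Notation L := (line D).
Implicit Types (delta d : H -> R) (tau e : L -> 'I_N -> R) (l : multipliers D).

(** The linear parts of the affine maps [clearing_lhs] and, below,
[flow_change]: exogenous bids and the flow of the previous day drop out. *)
Definition clearing_dir d e a t : R :=
  \sum_(h in curves_at D a t) d h
  + \sum_(c in lines_from D a) e c t - \sum_(c in lines_to D a) e c t.

Definition ramp_dir e (c : L) (t : 'I_N) : R :=
  e c t - (if t == 0 :> nat then 0 else e c (ord_pred t)).

Lemma clearing_dir_linear k d d' e e' a t :
  clearing_dir (fun h => k * d h + d' h) (fun c t => k * e c t + e' c t) a t =
  k * clearing_dir d e a t + clearing_dir d' e' a t.
Proof. by rewrite /clearing_dir !big_split /= -!mulr_sumr; ring. Qed.

Lemma ramp_dir_linear k e e' c t :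
  ramp_dir (fun c t => k * e c t + e' c t) c t = k * ramp_dir e c t + ramp_dir e' c t.
Proof. by rewrite /ramp_dir; case: ifP => _; ring. Qed.

Lemma clearing_shift delta tau d e a t :
  clearing_lhs beta phi (fun h => delta h + d h) (fun c t => tau c t + e c t) a t
  = clearing_lhs beta phi delta tau a t + clearing_dir d e a t.
Proof. by rewrite /clearing_lhs /clearing_dir !big_split /=; ring. Qed.

Lemma flow_change_shift tau e (c : L) (t : 'I_N) :
  flow_change (fun c t => tau c t + e c t) c t
  = flow_change tau c t + ramp_dir e c t.
Proof. by rewrite /flow_change /ramp_dir /prev_flow; case: ifP => _; ring. Qed.

Lemma objective_shift delta d :
  objective D beta phi (fun h => delta h + d h) =
  objective D beta phi delta + \sum_h bid_curve D h (delta h) * d h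
  - \sum_h curve_slope D h / 2 * d h ^+ 2.
Proof.
have oE x : \sum_h oriented_integral (bid_curve D h) 0 (x h) =
    \sum_h (curve_price D h * x h - curve_slope D h / 2 * x h ^+ 2).
  by apply: eq_bigr => h _; exact: oriented_integral_affine.
rewrite /objective !oE.
have -> : \sum_h (curve_price D h * (delta h + d h)
                  - curve_slope D h / 2 * (delta h + d h) ^+ 2) =
   \sum_h (curve_price D h * delta h - curve_slope D h / 2 * delta h ^+ 2)
   + \sum_h bid_curve D h (delta h) * d h
   - \sum_h curve_slope D h / 2 * d h ^+ 2.
  rewrite -big_split -sumrB /=; apply: eq_bigr => h _.
  by rewrite /bid_curve; field.
ring.
Qed.

Lemma lagrangian_shift l delta tau d e :
  lagrangian beta phi l (fun h => delta h + d h) (fun c t => tau c t + e c t) =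
  lagrangian beta phi l delta tau
  - \sum_h bid_curve D h (delta h) * d h
  + \sum_h curve_slope D h / 2 * d h ^+ 2
  + \sum_a \sum_t clearing_mult l a t * clearing_dir d e a t
  + \sum_h (v_hi l h - v_lo l h) * d h
  + \sum_c \sum_t (mu_hi l c t - mu_lo l c t) * e c t
  + \sum_c \sum_t (rho_hi l c t - rho_lo l c t) * ramp_dir e c t.
Proof.
have split2 (I : finType) (f g h : I -> 'I_N -> R) :
    (forall i t, f i t = g i t + h i t) ->
    \sum_i \sum_t f i t = \sum_i \sum_t g i t + \sum_i \sum_t h i t.
  move=> fgh; rewrite -big_split; apply: eq_bigr => i _ /=.
  by rewrite -big_split; apply: eq_bigr.
rewrite /lagrangian objective_shift.
rewrite (split2 _ _ _ _ (fun a t => etrans (congr1 _ (clearing_shift _ _ _ _ a t))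
                                          (mulrDr _ _ _))).
rewrite [X in _ + _ + X + _ + _ = _](_ : _ =
    \sum_h (v_hi l h * (delta h - delta_hi D h)
            + v_lo l h * (- delta h + delta_lo D h))
    + \sum_h (v_hi l h - v_lo l h) * d h); last first.
  by rewrite -big_split; apply: eq_bigr => h _ /=; ring.
rewrite [X in _ + X + _ = _](split2 _ _
   (fun c t => mu_hi l c t * (tau c t - tau_hi D c t)
               + mu_lo l c t * (- tau c t + tau_lo D c t))
   (fun c t => (mu_hi l c t - mu_lo l c t) * e c t)); last first.
  by move=> c t; ring.
rewrite [X in _ + X = _](split2 _ _
   (fun c t => rho_hi l c t * (flow_change tau c t - fine (ramp D c))
       + rho_lo l c t * (- flow_change tau c t - fine (ramp D c)))
   (fun c t => (rho_hi l c t - rho_lo l c t) * ramp_dir e c t)); last first.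
  by move=> c t; rewrite flow_change_shift; ring.
ring.
Qed.

(** Each bid curve enters a single clearing constraint, whereas at each slot
a line enters that of its source and, with the opposite sign, that of its target:
hence the price difference between its ends. *)
Lemma clearing_by_parts (pi : A -> 'I_N -> R) d e :
  \sum_a \sum_t pi a t * clearing_dir d e a t =
  \sum_h pi (curve_area D h) (curve_slot D h) * d h
  + \sum_(c : L) \sum_t (pi (val c).1 t - pi (val c).2 t) * e c t.
Proof.
have end_sum (k : L -> A) :
    \sum_c \sum_t pi (k c) t * e c t =
    \sum_a \sum_t \sum_(c | k c == a) pi a t * e c t.
  rewrite exchange_big [RHS]exchange_big /=; apply: eq_bigr => t _.
  rewrite (partition_big k xpredT)//=; apply: eq_bigr => a _.
  by apply: eq_bigr => c /eqP ->.
have -> : \sum_(c : L) \sum_t (pi (val c).1 t - pi (val c).2 t) * e c t =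
    \sum_(c : L) \sum_t pi (val c).1 t * e c t
    - \sum_(c : L) \sum_t pi (val c).2 t * e c t.
  rewrite -sumrB; apply: eq_bigr => c _; rewrite -sumrB.
  by apply: eq_bigr => t _; rewrite mulrBl.
rewrite !end_sum (partition_big (fun h => (curve_area D h, curve_slot D h)) xpredT)//=.
rewrite -(pair_bigA _ (fun a t =>
  \sum_(h | (curve_area D h, curve_slot D h) == (a, t))
     pi (curve_area D h) (curve_slot D h) * d h)) /=.
rewrite -sumrB -big_split /=; apply: eq_bigr => a _.
rewrite -sumrB -big_split /=; apply: eq_bigr => t _.
rewrite /clearing_dir mulrBr mulrDr !mulr_sumr addrA; congr (_ + _ - _).
- apply: eq_big => [h|h]; first by rewrite inE xpair_eqE.
  by rewrite inE => /andP[/eqP-> /eqP->].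
- by apply: eq_bigl => c; rewrite inE.
- by apply: eq_bigl => c; rewrite inE.
Qed.

(** Summation by parts in time: the flow of slot [t] enters the ramping
constraints of [t] and of [t + 1], which is where [next_ramp] comes from. *)
Lemma ramp_by_parts (rhohi rholo : L -> 'I_N -> R) e :
  \sum_c \sum_t (rhohi c t - rholo c t) * ramp_dir e c t =
  \sum_c \sum_t (rhohi c t - rholo c t + next_ramp rhohi rholo c t) * e c t.
Proof.
apply: eq_bigr => c _.
under eq_bigr do rewrite /ramp_dir mulrBr.
under [RHS]eq_bigr do rewrite mulrDl.
rewrite sumrB [RHS]big_split /=; congr (_ + _).
(* cyclic shift of the slots; its wrap-around term is zero on both sides *)
rewrite (reindex_inj (@ordS_inj N)) /= -sumrN; apply: eq_bigr => t _.
rewrite ordSK /next_ramp /=.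
case: (ltngtP t.+1 N) (ltn_ord t) => // [tN|tN] _; first by rewrite modn_small//=; ring.
by rewrite tN modnn /=; ring.
Qed.

(** * Stationarity residuals *)

Definition curve_residual l delta (h : H) : R :=
  - bid_curve D h (delta h) + clearing_mult l (curve_area D h) (curve_slot D h)
  + v_hi l h - v_lo l h.

Definition flow_residual l (c : L) (t : 'I_N) : R :=
  (mu_hi l c t - mu_lo l c t) + (rho_hi l c t - rho_lo l c t)
  + next_ramp (rho_hi l) (rho_lo l) c t
  + clearing_mult l (val c).1 t - clearing_mult l (val c).2 t.

(** The Lagrangian is quadratic with diagonal second-order part, so this
expansion is exact; its linear coefficients are the two residuals. *)
Lemma lagrangian_taylor l delta tau d e :
  lagrangian beta phi l (fun h => delta h + d h) (fun c t => tau c t + e c t) =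
  lagrangian beta phi l delta tau
  + \sum_h curve_residual l delta h * d h
  + \sum_c \sum_t flow_residual l c t * e c t
  + \sum_h curve_slope D h / 2 * d h ^+ 2.
Proof.
rewrite lagrangian_shift clearing_by_parts ramp_by_parts.
have -> : \sum_h curve_residual l delta h * d h =
  - \sum_h bid_curve D h (delta h) * d h
  + \sum_h clearing_mult l (curve_area D h) (curve_slot D h) * d h
  + \sum_h (v_hi l h - v_lo l h) * d h.
  rewrite -sumrN -!big_split /=; apply: eq_bigr => h _.
  by rewrite /curve_residual; ring.
have -> : \sum_c \sum_t flow_residual l c t * e c t =
  \sum_c \sum_t (mu_hi l c t - mu_lo l c t) * e c t
  + \sum_c \sum_t (rho_hi l c t - rho_lo l c t
                    + next_ramp (rho_hi l) (rho_lo l) c t) * e c t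
  + \sum_(c : L) \sum_t
      (clearing_mult l (val c).1 t - clearing_mult l (val c).2 t) * e c t.
  rewrite -!big_split /=; apply: eq_bigr => c _.
  rewrite -!big_split /=; apply: eq_bigr => t _.
  by rewrite /flow_residual; ring.
ring.
Qed.

(** * Weak duality and complementary slackness *)

Definition complementary l delta tau : Prop :=
  [/\ forall h, v_hi l h * (delta h - delta_hi D h) = 0
             /\ v_lo l h * (- delta h + delta_lo D h) = 0,
      forall c t, mu_hi l c t * (tau c t - tau_hi D c t) = 0
             /\ mu_lo l c t * (- tau c t + tau_lo D c t) = 0
    & forall c t, rho_hi l c t * (flow_change tau c t - fine (ramp D c)) = 0
             /\ rho_lo l c t * (- flow_change tau c t - fine (ramp D c)) = 0].

Lemma lagrangian_terms_le0 l delta tau :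
  dual_feasible l -> feasible beta phi delta tau ->
  [/\ forall h, v_hi l h * (delta h - delta_hi D h) <= 0
             /\ v_lo l h * (- delta h + delta_lo D h) <= 0,
      forall c t, mu_hi l c t * (tau c t - tau_hi D c t) <= 0
             /\ mu_lo l c t * (- tau c t + tau_lo D c t) <= 0
    & forall c t, rho_hi l c t * (flow_change tau c t - fine (ramp D c)) <= 0
             /\ rho_lo l c t * (- flow_change tau c t - fine (ramp D c)) <= 0].
Proof.
move=> [v0 mu0 rho0 rhooo] [_ dB tB rB]; split.
- move=> h; have [? ?] := v0 h; have /andP[? ?] := dB h.
  by split; apply: mulr_ge0_le0 => //; lra.
- move=> c t; have [? ?] := mu0 c t; have /andP[? ?] := tB c t.
  by split; apply: mulr_ge0_le0 => //; lra.
- move=> c t; have [r1 r2] := rho0 c t; have := rB c t.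
  have := rhooo c t; have := ramp_ge0 c; case: (ramp D c) => [r _ _|_ /(_ erefl)[-> ->] _|//].
    rewrite -EFinN !lee_fin => /andP[? ?].
    by split; apply: mulr_ge0_le0 => //=; lra.
  by rewrite !mul0r.
Qed.

Lemma lagrangian_feasible l delta tau : feasible beta phi delta tau ->
  lagrangian beta phi l delta tau = - objective D beta phi delta
  + \sum_h (v_hi l h * (delta h - delta_hi D h)
            + v_lo l h * (- delta h + delta_lo D h))
  + \sum_c \sum_t (mu_hi l c t * (tau c t - tau_hi D c t)
                   + mu_lo l c t * (- tau c t + tau_lo D c t))
  + \sum_c \sum_t (rho_hi l c t * (flow_change tau c t - fine (ramp D c))
                   + rho_lo l c t * (- flow_change tau c t - fine (ramp D c))).
Proof.
move=> [clr _ _ _]; rewrite /lagrangian [X in _ + X + _ + _ + _]big1 ?addr0//.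
by move=> a _; rewrite big1// => t _; rewrite clr mulr0.
Qed.

Lemma lagrangian_complementary l delta tau :
  feasible beta phi delta tau -> complementary l delta tau ->
  lagrangian beta phi l delta tau = - objective D beta phi delta.
Proof.
move=> fe [cv cmu crho]; rewrite lagrangian_feasible//.
rewrite big1 => [|h _]; last by have [-> ->] := cv h; rewrite addr0.
rewrite big1 => [|c _]; last first.
  by rewrite big1// => t _; have [-> ->] := cmu c t; rewrite addr0.
rewrite big1 ?addr0// => c _.
by rewrite big1// => t _; have [-> ->] := crho c t; rewrite addr0.
Qed.

Lemma weak_duality l delta tau :
  dual_feasible l -> feasible beta phi delta tau ->
  lagrangian beta phi l delta tau <= - objective D beta phi delta.
Proof.
move=> df fe; have [tv tmu trho] := lagrangian_terms_le0 df fe.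
rewrite lagrangian_feasible// -!addrA gerDl.
have add0 (x y : R) : x <= 0 /\ y <= 0 -> x + y <= 0 by lra.
apply: (add0 _ _); split; last (apply: (add0 _ _); split).
- by apply: sumr_le0 => h _; exact/add0/tv.
- by do 2![apply: sumr_le0 => ? _]; exact/add0/tmu.
- by do 2![apply: sumr_le0 => ? _]; exact/add0/trho.
Qed.

(** The gap in weak duality is a sum of nonpositive slackness terms, so equality
kills each of them. *)
Lemma tight_complementary l delta tau :
  dual_feasible l -> feasible beta phi delta tau ->
  - objective D beta phi delta <= lagrangian beta phi l delta tau ->
  complementary l delta tau.
Proof.
move=> df fe; have [tv tmu trho] := lagrangian_terms_le0 df fe.
rewrite lagrangian_feasible// -!addrA lerDl.
set sv := \sum_(h : H) _; set srho := \sum_(c : L) \sum_t (rho_hi l c t * _ + _).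
set smu := \sum_(c : L) _ => tight.
have add0 (x y : R) : x <= 0 /\ y <= 0 -> x + y <= 0 by lra.
have add_eq0 (x y : R) : x <= 0 /\ y <= 0 -> x + y = 0 -> x = 0 /\ y = 0 by lra.
have sum2_eq0 (f : L -> 'I_N -> R) : (forall c t, f c t <= 0) ->
    0 <= \sum_c \sum_t f c t -> forall c t, f c t = 0.
  move=> f0 s0 c; apply: sum_le0_eq0 => //.
  by rewrite (sum_le0_eq0 _ s0)// => c'; exact: sumr_le0.
have sv0 : sv <= 0 by apply: sumr_le0 => h _; exact/add0/tv.
have smu0 : smu <= 0 by do 2![apply: sumr_le0 => ? _]; exact/add0/tmu.
have srho0 : srho <= 0 by do 2![apply: sumr_le0 => ? _]; exact/add0/trho.
split.
- move=> h; apply: (add_eq0 _ _ (tv h) _); move: h; apply: sum_le0_eq0.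
    by move=> h; exact/add0/tv.
  by rewrite -/sv; lra.
- move=> c t; apply: (add_eq0 _ _ (tmu c t) _); move: c t; apply: (sum2_eq0 _).
    by move=> c t; exact/add0/tmu.
  by rewrite -/smu; lra.
- move=> c t; apply: (add_eq0 _ _ (trho c t) _); move: c t; apply: (sum2_eq0 _).
    by move=> c t; exact/add0/trho.
  by rewrite -/srho; lra.
Qed.

(** * Certificates and Karush-Kuhn-Tucker points *)

(** The bound ranges over all of the variable space, feasible or not: it says
that the dual objective at [l] is at least minus the objective at [delta]. *)
Definition certificate l delta : Prop :=
  dual_feasible l /\
  forall delta' tau', - objective D beta phi delta <= lagrangian beta phi l delta' tau'.

Definition kkt_point l delta tau : Prop :=
  [/\ dual_feasible l, complementary l delta tau,
      forall h, curve_residual l delta h = 0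
    & forall c t, flow_residual l c t = 0].

Lemma shiftE (x y : H -> R) : (fun h => x h + (y h - x h)) = y.
Proof. by apply/funext => h; rewrite subrKC. Qed.

Lemma shift2E (x y : L -> 'I_N -> R) : (fun c t => x c t + (y c t - x c t)) = y.
Proof. by apply/funext => c; apply/funext => t; rewrite subrKC. Qed.

Lemma slope_term_ge0 d : 0 <= \sum_h curve_slope D h / 2 * d h ^+ 2.
Proof.
by apply: sumr_ge0 => h _; rewrite mulr_ge0 ?sqr_ge0// divr_ge0// curve_slope_ge0.
Qed.

(** A stationary point of the convex Lagrangian minimizes it, and complementarity
makes its value there equal to minus the objective. *)
Lemma kkt_certificate l delta tau : feasible beta phi delta tau ->
  kkt_point l delta tau -> certificate l delta.
Proof.
move=> fe [df co cr fr]; split=> // delta' tau'.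
rewrite -(shiftE delta delta') -(shift2E tau tau') lagrangian_taylor.
rewrite (lagrangian_complementary fe co).
rewrite big1 => [|h _]; last by rewrite cr mul0r.
rewrite big1 => [|c _]; last by rewrite big1// => t _; rewrite fr mul0r.
rewrite !addr0 lerDl; exact: slope_term_ge0.
Qed.

(** Together with weak duality the bound makes the given point minimize the
Lagrangian; moving one variable at a time then kills each residual. *)
Lemma certificate_kkt l delta tau : feasible beta phi delta tau ->
  certificate l delta -> kkt_point l delta tau.
Proof.
move=> fe [df cert].
have co : complementary l delta tau by exact: tight_complementary (cert _ _).
have taylor d e : 0 <= \sum_h curve_residual l delta h * d h
    + \sum_c \sum_t flow_residual l c t * e c t
    + \sum_h curve_slope D h / 2 * d h ^+ 2.
  have := cert (fun h => delta h + d h) (fun c t => tau c t + e c t).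
  by rewrite lagrangian_taylor (lagrangian_complementary fe co) -!addrA lerDl.
split => // [h|c t].
- apply: (@linear_coef0 _ _ (curve_slope D h / 2)) => [|x].
    by rewrite divr_ge0// curve_slope_ge0.
  have := taylor (fun h' => if h' == h then x else 0) (fun _ _ => 0).
  rewrite [X in _ + X + _]big1 ?addr0 => [|c _]; last first.
    by rewrite big1// => t _; rewrite mulr0.
  rewrite (bigD1 h)//= eqxx [X in _ + X + _]big1 ?addr0 => [|i /negPf ->]; last first.
    by rewrite mulr0.
  rewrite (bigD1 h)//= eqxx [X in _ + (_ + X)]big1 ?addr0// => i /negPf ->.
  by rewrite expr0n mulr0.
- apply: (@linear_coef0 _ _ 0) => // x; rewrite mul0r addr0.
  have := taylor (fun=> 0) (fun c' t' => if (c' == c) && (t' == t) then x else 0).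
  rewrite big1 ?add0r => [|h _]; last by rewrite mulr0.
  rewrite [X in _ + X]big1 ?addr0 => [|h _]; last by rewrite expr0n mulr0.
  rewrite (bigD1 c)//= [X in _ + X]big1 ?addr0 => [|c' /negPf cc]; last first.
    by rewrite big1// => t' _; rewrite cc mulr0.
  rewrite (bigD1 t)//= !eqxx [X in _ + X]big1 ?addr0// => t' /negPf tt.
  by rewrite tt mulr0.
Qed.

Lemma certificate_optimal l delta tau : feasible beta phi delta tau ->
  certificate l delta -> optimal beta phi delta tau.
Proof.
move=> fe [df cert]; split => // delta' tau' fe'.
by rewrite -lerN2 (le_trans (cert _ _) (weak_duality df fe')).
Qed.

(** * Dual optimality *)

Lemma dual_objective_ge l (x : R) :
  (x%:E <= dual_objective beta phi l)%E <->
  forall delta tau, x <= lagrangian beta phi l delta tau.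
Proof.
split=> [xle delta tau|xle].
  rewrite -lee_fin (le_trans xle)//; apply: ereal_inf_lbound.
  by exists (delta, tau).
by apply: le_ereal_inf_tmp => _ [[delta tau] _ <-]; rewrite lee_fin.
Qed.

(** By weak duality the dual value of dual feasible multipliers is at most minus the
objective at the feasible point; [l0] attains this bound, so attaining it
characterizes dual optimality. *)
Lemma dual_optimal_certificate l0 l delta tau : feasible beta phi delta tau ->
  certificate l0 delta -> dual_optimal beta phi l <-> certificate l delta.
Proof.
move=> fe [df0 cert0]; split=> [[df opt]|[df cert]]; split => //.
- apply/dual_objective_ge; apply: le_trans (opt _ df0).
  exact/dual_objective_ge.
- move=> l' df'; apply: (@le_trans _ _ (- objective D beta phi delta)%:E).
    apply: ge_ereal_inf; exists (lagrangian beta phi l' delta tau)%:E.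
      by exists (delta, tau).
    by rewrite lee_fin weak_duality.
  exact/dual_objective_ge.
Qed.

(** The two conditions quantify their multipliers separately; they share only
the prices, so these multipliers assemble into one vector. *)
Lemma kkt_point_conditions delta tau (pi : A -> 'I_N -> R) :
  feasible beta phi delta tau ->
  (filling_condition D delta pi /\ flow_price_condition tau pi) <->
  exists2 l, kkt_point l delta tau & clearing_mult l = pi.
Proof.
move=> [_ dB tB _]; split.
- move=> [[_ [vhi [vlo fill]]] [_ [muhi [mulo [rhohi [rholo flow]]]]]].
  exists (Multipliers pi vhi vlo muhi mulo rhohi rholo) => //.
  have at_self h : h \in curves_at D (curve_area D h) (curve_slot D h).
    by rewrite inE !eqxx.
  split; first split => /=.
  + by move=> h; have [] := fill _ _ _ (at_self h).
  + by move=> c t; have [[]] := flow c t.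
  + by move=> c t; have [[]] := flow c t.
  + by move=> c t; have [] := flow c t.
  + split=> /=.
    * by move=> h; have [_ ? ?] := fill _ _ _ (at_self h); rewrite !(mulrC (_ h)).
    * by move=> c t; have [_ _ _ [? ?] _] := flow c t; rewrite !(mulrC (_ t)).
    * move=> c t; have [_ _ _ _ [r1 r2]] := flow c t.
      split; first by rewrite mulrC.
      by rewrite /flow_change opprB mulrC.
  + by move=> h; have [] := fill _ _ _ (at_self h).
  + by move=> c t; have [] := flow c t.
- move=> [l [[v0 mu0 rho0 rhooo] [cv cmu crho] cr fr] <-]; split; split => //.
  + exists (v_hi l), (v_lo l) => a t h; rewrite inE => /andP[/eqP <- /eqP <-].
    have [? ?] := v0 h; have [c1 c2] := cv h.
    by split => //; [exact: cr|rewrite mulrC c1|rewrite mulrC c2].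
  + exists (mu_hi l), (mu_lo l), (rho_hi l), (rho_lo l) => c t.
    have [? ?] := mu0 c t; have [? ?] := rho0 c t.
    have [m1 m2] := cmu c t; have [r1 r2] := crho c t.
    split => //; [exact: rhooo|exact: fr|split; by rewrite mulrC|].
    by split; [rewrite mulrC -[RHS]r1|rewrite mulrC -[RHS]r2 /flow_change opprB].
Qed.

(** * Strong duality *)

(** The constraints are fed to [quadratic_kkt] as four families of
two-sided bounds, the clearing equation being bounded by zero on both sides;
its price is the difference of the two multipliers. *)
Lemma optimal_certificate delta tau : optimal beta phi delta tau ->
  exists l, certificate l delta.
Proof.
move=> [fe opt]; have [clr dB tB rB] := fe.
pose V := {ffun H + L * 'I_N -> R^o}.
pose dH (x : V) h : R := x (inl h).
pose dL (x : V) c t : R := x (inr (c, t)).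
have dHL k x y : dH (k *: x + y) = fun h => k * dH x h + dH y h.
  by apply/funext => h; rewrite /dH !ffunE.
have dLL k x y : dL (k *: x + y) = fun c t => k * dL x c t + dL y c t.
  by apply/funext => c; apply/funext => t; rewrite /dL !ffunE.
pose J : finType := ((A * 'I_N) + (H + ((L * 'I_N) + (L * 'I_N))))%type.
pose form (j : J) (x : V) : R := match j with
  | inl at_ => clearing_dir (dH x) (dL x) at_.1 at_.2
  | inr (inl h) => dH x h
  | inr (inr (inl ct)) => dL x ct.1 ct.2
  | inr (inr (inr ct)) => ramp_dir (dL x) ct.1 ct.2
  end.
pose z (j : J) : R := match j with
  | inl at_ => 0
  | inr (inl h) => delta h
  | inr (inr (inl ct)) => tau ct.1 ct.2
  | inr (inr (inr ct)) => flow_change tau ct.1 ct.2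
  end.
pose lo (j : J) : \bar R := match j with
  | inl at_ => 0%E
  | inr (inl h) => (delta_lo D h)%:E
  | inr (inr (inl ct)) => (tau_lo D ct.1 ct.2)%:E
  | inr (inr (inr ct)) => (- ramp D ct.1)%E
  end.
pose hi (j : J) : \bar R := match j with
  | inl at_ => 0%E
  | inr (inl h) => (delta_hi D h)%:E
  | inr (inr (inl ct)) => (tau_hi D ct.1 ct.2)%:E
  | inr (inr (inr ct)) => ramp D ct.1
  end.
pose g (x : V) : R := \sum_h bid_curve D h (delta h) * dH x h.
pose q (x : V) : R := \sum_h curve_slope D h / 2 * dH x h ^+ 2.
have formL j : scalar (form j).
  by case: j => [[a t]|[h|[[c t]|[c t]]]] k x y; rewrite /form ?dHL ?dLL
    ?clearing_dir_linear ?ramp_dir_linear.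
have gL : scalar g.
  move=> k x y; rewrite /g dHL mulr_sumr -big_split /=; apply: eq_bigr => h _.
  by rewrite mulrDr mulrCA.
have q2 k x : q (k *: x) = k ^+ 2 * q x.
  rewrite /q mulr_sumr; apply: eq_bigr => h _.
  by rewrite /dH ffunE exprMn mulrCA.
have [||lamhi [lamlo [lam0 lamhi0 lamlo0 gE]]] :=
    @quadratic_kkt R V J form z lo hi g q formL gL q2.
- by case=> [[a t]|[h|[[c t]|[c t]]]] /=; rewrite ?lexx ?lee_fin.
- move=> x dfe.
  have := opt (fun h => delta h + dH x h) (fun c t => tau c t + dL x c t).
  rewrite objective_shift -addrA gerDl subr_le0; apply; split.
  + move=> a t; rewrite clearing_shift clr add0r.
    have := dfe (inl (a, t)); rewrite /= add0r !lee_fin => /andP[? ?].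
    by apply/eqP; rewrite eq_le; apply/andP.
  + by move=> h; have := dfe (inr (inl h)); rewrite /= !lee_fin.
  + by move=> c t; have := dfe (inr (inr (inl (c, t)))); rewrite /= !lee_fin.
  + by move=> c t; have := dfe (inr (inr (inr (c, t)))); rewrite /= flow_change_shift.
pose l := Multipliers (D := D)
  (fun a t => lamhi (inl (a, t)) - lamlo (inl (a, t)))
  (fun h => lamhi (inr (inl h))) (fun h => lamlo (inr (inl h)))
  (fun c t => lamhi (inr (inr (inl (c, t))))) (fun c t => lamlo (inr (inr (inl (c, t)))))
  (fun c t => lamhi (inr (inr (inr (c, t))))) (fun c t => lamlo (inr (inr (inr (c, t))))).
(* a bound either is attained or has a zero multiplier *)
have slack_hi j u : hi j = u%:E -> lamhi j * (z j - u) = 0.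
  move=> hij; have [zu|zu] := eqVneq u (z j); first by rewrite zu subrr mulr0.
  by rewrite lamhi0 ?mul0r// hij.
have slack_lo j u : lo j = u%:E -> lamlo j * (- z j + u) = 0.
  move=> loj; have [zu|zu] := eqVneq u (z j); first by rewrite zu addNr mulr0.
  by rewrite lamlo0 ?mul0r// loj.
have df : dual_feasible l.
  split=> [h|c t|c t|c t roo]; try exact: lam0.
  by split; [apply: lamhi0|apply: lamlo0]; rewrite /= roo.
have co : complementary l delta tau.
  split=> [h|c t|c t] /=.
  - by split; [exact: (slack_hi (inr (inl h)))|exact: (slack_lo (inr (inl h)))].
  - by split; [exact: (slack_hi (inr (inr (inl (c, t)))))
              |exact: (slack_lo (inr (inr (inl (c, t)))))].
  - have := ramp_ge0 c; case r: (ramp D c) => [x| |]// _.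
    + by split; [exact: (slack_hi (inr (inr (inr (c, t)))))
                |apply: (slack_lo (inr (inr (inr (c, t))))); rewrite /= r].
    + by have [_ _ _ /(_ c t r)[/= -> ->]] := df; rewrite !mul0r.
(* by gE the constraint terms of lagrangian_shift cancel the first-order
   gain, so only the quadratic term survives *)
exists l; split => // delta' tau'.
pose x : V := [ffun i => match i with
  | inl h => delta' h - delta h
  | inr ct => tau' ct.1 ct.2 - tau ct.1 ct.2
  end].
have -> : delta' = fun h => delta h + dH x h.
  by apply/funext => h; rewrite /dH ffunE subrKC.
have -> : tau' = fun c t => tau c t + dL x c t.
  by apply/funext => c; apply/funext => t; rewrite /dL ffunE subrKC.
rewrite lagrangian_shift (lagrangian_complementary fe co) -/(g x) gE.
have pairE (I I' : finType) (f : I * I' -> R) : \sum_p f p = \sum_i \sum_j f (i, j).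
  by rewrite pair_bigA; apply: eq_bigr => -[].
rewrite !big_sumType !pairE /=.
have := slope_term_ge0 (dH x); lra.
Qed.
End Market.

(** * Characterization of optimal flows by prices *)

Theorem theorem5p1 (R : realType) (A H B F : finType) (N : nat)
    (D : market R A H B F N)
    (beta : B -> bool) (phi : F -> 'I_N -> bool)
    (delta : H -> R) (tau : line D -> 'I_N -> R) :
  feasible beta phi delta tau ->
  (optimal beta phi delta tau <->
     exists pi : A -> 'I_N -> R,
       filling_condition D delta pi /\ flow_price_condition tau pi) /\
  (optimal beta phi delta tau ->
     forall pi : A -> 'I_N -> R,
       (filling_condition D delta pi /\ flow_price_condition tau pi) <->
       exists l : multipliers D,
         dual_optimal beta phi l /\ clearing_mult l = pi).
Proof.
move=> fe; split; first split.
- move=> /optimal_certificate[l /(certificate_kkt fe) kl].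
  by exists (clearing_mult l); apply/(kkt_point_conditions _ fe); exists l.
- move=> [pi /(kkt_point_conditions _ fe)[l kl _]].
  exact: certificate_optimal fe (kkt_certificate fe kl).
- move=> /optimal_certificate[l0 cert0] pi.
  have dualE l := dual_optimal_certificate l fe cert0.
  rewrite (kkt_point_conditions _ fe); split.
  + by move=> [l /(kkt_certificate fe)/dualE dl lpi]; exists l.
  + by move=> [l [/dualE/(certificate_kkt fe) kl lpi]]; exists l.
Qed.
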